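(* Let $n$ be a positive integer such that $3\mid n$ and $n$ is not a power of $3$. Then the shuffle group $G_{3,3n}$ is $2$-transitive on $[3n]=\{0,1,\ldots,3n-1\}$.
   Context: For a positive integer $m$ let $[m]:=\{0,1,\ldots,m-1\}$. Every element of $[3n]$ is uniquely written as $i+jn$ with $i\in[n]$ and $j\in[3]$. Permutations act on the right, written $x^{g}$. The standard shuffle $\sigma\in\mathrm{Sym}([3n])$ is defined by $(i+jn)^{\sigma}=3i+j$ for all $i\in[n]$, $j\in[3]$. For $\tau\in\mathrm{Sym}([3])$, the permutation $\rho_{\tau}\in\mathrm{Sym}([3n])$ is defined by $(i+jn)^{\rho_{\tau}}=i+j^{\tau}n$ for all $i\in[n]$, $j\in[3]$. The shuffle group $G_{3,3n}$ is the subgroup of $\mathrm{Sym}([3n])$ generated by $\{\rho_{\tau}\sigma\mid\tau\in\mathrm{Sym}([3])\}$ (products performed from left to right); equivalently, $G_{3,3n}=\langle\sigma,\rho_{\tau}\mid\tau\in\mathrm{Sym}([3])\rangle$. *)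

(* Defs.v *)
From mathcomp Require Import all_boot all_fingroup all_solvable.

Set Implicit Arguments.
Unset Strict Implicit.
Unset Printing Implicit Defensive.

Local Open Scope nat_scope.

(* A point of [3n] is a position in a deck of 3n cards cut into three piles of
   n cards: x = i + j * n, with i = x %% n the depth of the card in its pile
   and j = x %/ n the pile. *)

Lemma point_subproof n (i : 'I_n) (j : 'I_3) : i + j * n < 3 * n.
Proof.
apply: (@leq_trans (j.+1 * n)); last by rewrite leq_mul2r ltn_ord orbT.
by rewrite mulSn ltn_add2r ltn_ord.
Qed.

Definition point n (i : 'I_n) (j : 'I_3) : 'I_(3 * n) :=
  Ordinal (point_subproof i j).

Lemma depth_subproof n (x : 'I_(3 * n)) : x %% n < n.
Proof. by case: n x => [|n] x; [case: x => m; rewrite muln0 | rewrite ltn_mod]. Qed.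

Definition depth n (x : 'I_(3 * n)) : 'I_n := Ordinal (depth_subproof x).

Lemma pile_subproof n (x : 'I_(3 * n)) : x %/ n < 3.
Proof. by case: n x => [|n] x; rewrite ?divn0 // ltn_divLR. Qed.

Definition pile n (x : 'I_(3 * n)) : 'I_3 := Ordinal (pile_subproof x).

Lemma pointK n (x : 'I_(3 * n)) : point (depth x) (pile x) = x.
Proof. by apply: val_inj; rewrite /= addnC -divn_eq. Qed.

Lemma depth_point n (i : 'I_n) (j : 'I_3) : depth (point i j) = i.
Proof. by apply: val_inj; rewrite /= addnC modnMDl modn_small. Qed.

Lemma pile_point n (i : 'I_n) (j : 'I_3) : pile (point i j) = j.
Proof.
have n_gt0 : 0 < n by apply: leq_ltn_trans (ltn_ord i).
by apply: val_inj; rewrite /= addnC divnMDl // divn_small ?addn0.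
Qed.

Lemma shuffle_fun_subproof n (i : 'I_n) (j : 'I_3) : 3 * i + j < 3 * n.
Proof.
apply: (@leq_trans (3 * i.+1)); last by rewrite leq_mul2l ltn_ord.
by rewrite mulnS addnC ltn_add2r ltn_ord.
Qed.

Definition shuffle_fun n (x : 'I_(3 * n)) : 'I_(3 * n) :=
  Ordinal (shuffle_fun_subproof (depth x) (pile x)).

Lemma shuffle_fun_inj n : injective (@shuffle_fun n).
Proof.
have aux (i k : 'I_n) (j l : 'I_3) :
    3 * i + j = 3 * k + l -> point i j = point k l.
  rewrite !(mulnC 3) => e; congr point; apply: val_inj.
    by move: (congr1 (divn^~ 3) e); rewrite !divnMDl // !divn_small ?addn0.
  by move: (congr1 (modn^~ 3) e); rewrite !modnMDl !modn_small.
by move=> x y /(congr1 val) /aux; rewrite !pointK.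
Qed.

Definition shuffle n : {perm 'I_(3 * n)} := perm (@shuffle_fun_inj n).

Definition pile_perm_fun n (tau : 'S_3) (x : 'I_(3 * n)) : 'I_(3 * n) :=
  point (depth x) (tau (pile x)).

Lemma pile_perm_fun_inj n (tau : 'S_3) : injective (@pile_perm_fun n tau).
Proof.
move=> x y e; rewrite -(pointK x) -(pointK y); congr point.
  by rewrite -[LHS](depth_point _ (tau (pile x))) [point _ _]e depth_point.
apply: (@perm_inj _ tau).
by rewrite -[LHS](pile_point (depth x)) [point _ _]e pile_point.
Qed.

Definition pile_perm n (tau : 'S_3) : {perm 'I_(3 * n)} :=
  perm (@pile_perm_fun_inj n tau).

Lemma shuffleE n (i : 'I_n) (j : 'I_3) : shuffle n (point i j) = 3 * i + j :> nat.
Proof. by rewrite permE /shuffle_fun depth_point pile_point. Qed.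

Lemma pile_permE n (tau : 'S_3) (i : 'I_n) (j : 'I_3) :
  pile_perm n tau (point i j) = point i (tau j).
Proof. by rewrite permE /pile_perm_fun depth_point pile_point. Qed.

(* G_{3,3n}.  The product of permutations s * t applies s first. *)
Definition shuffle_group n : {group {perm 'I_(3 * n)}} :=
  <<[set (pile_perm n tau * shuffle n)%g | tau : 'S_3]>>%G.

(* Main.v *)
Require Import Defs.
From mathcomp Require Import all_boot all_fingroup all_solvable.
From mathcomp Require Import zify.

(** Write n = 3^a * m with m prime to 3; since n is not a power of 3, m > 1.
    The idea is to find, inside the shuffle group, the group generated by just
    two copies of Sym(3) acting on a deck of 3m cards, and to show that this
    smaller group is already 2-transitive.

    A position z < 3n is cut as z = 3^a * u + v with u < 3m and v < 3^a.
    Permuting the piles permutes the top digit j of u = i + j*m and leaves i and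
    v alone.  The power shuffle^(a+1) exchanges the leading a+1 ternary digits
    of a position with the remainder (moves_rotate), so conjugating the pile
    permutations by it permutes the bottom digit r of u = 3*k + r and leaves k
    and v alone.

    Combinatorial core (pair_transitive_lt): for m > 1 prime to 3, top and
    bottom moves together carry (0, 1) to any pair of distinct points of [3m].
    One goes by induction on the difference d of the pair.  Bottom moves shrink
    d whenever the two last digits can be brought to (2, 0); this handles the d
    prime to 3, because shifting both points by m changes their residues mod 3.
    If 3 divides d >= m, a top move shrinks d.  If 3 divides d < m, all pairs of
    difference d are equivalent to each other, and one of them can be reached
    from a pair of difference d + 1 or d + 2, which is prime to 3.
    For m = 1 the top and bottom digits coincide and the argument breaks down.

    From the core to the shuffle group: pairs of positions with prescribed v's
    are moved exactly as pairs of u's (moves_middle).  Hence, in the stabilizer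
    of 0, all z = 3^a * u + v with u > 0 and v fixed are in one orbit O_v.
    Rotating by a digits, O_v also contains all 3m * v + x with 0 < x < 3m.
    Two consecutive positions y, y + 1 not divisible by 3m thus lie in the same
    orbit; a suitable y congruent to v mod 3^a gives O_v = O_(v+1).  A position 0 < z < 3^a is
    sent to 3z by the shuffle, and eventually becomes at least 3^a.  So the
    stabilizer of 0 is transitive on the nonzero positions (moves_nonzero).
    As 0 itself can be moved, the group is 2-transitive. *)

Set Implicit Arguments.
Unset Strict Implicit.
Unset Printing Implicit Defensive.

Local Open Scope nat_scope.

(** * Top and bottom moves on pairs of points of [3m] *)

(** A permutation of the three top digits acts on both points at once, and Sym(3)
    can send the digits (j, j') to (t, t') exactly when j = j' <-> t = t'. *)
Definition top_closed m (P : nat -> nat -> Prop) :=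
  forall i i' j j' t t', i < m -> i' < m -> j < 3 -> j' < 3 -> t < 3 -> t' < 3 ->
  (j == j') = (t == t') -> P (i + j * m) (i' + j' * m) -> P (i + t * m) (i' + t' * m).

Definition bottom_closed m (P : nat -> nat -> Prop) :=
  forall k k' r r' s s', k < m -> k' < m -> r < 3 -> r' < 3 -> s < 3 -> s' < 3 ->
  (r == r') = (s == s') -> P (3 * k + r) (3 * k' + r') -> P (3 * k + s) (3 * k' + s').

Lemma bottom_move m P x y x' y' : bottom_closed m P -> x < 3 * m -> y < 3 * m ->
  x' %/ 3 = x %/ 3 -> y' %/ 3 = y %/ 3 ->
  (x %% 3 == y %% 3) = (x' %% 3 == y' %% 3) -> P x y -> P x' y'.
Proof.
move=> bot xm ym ex ey er Pxy.
rewrite (divn_eq x' 3) (divn_eq y' 3) ex ey ![_ * 3]mulnC.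
apply: (bot _ _ (x %% 3) (y %% 3)); rewrite ?ltn_mod ?ltn_divLR 1?mulnC //.
by rewrite ![3 * _]mulnC -!divn_eq.
Qed.

Lemma shift_up m P x y : top_closed m P -> x < 2 * m -> y < 2 * m ->
  P x y -> P (x + m) (y + m).
Proof.
move=> top xm ym; have m0 : 0 < m by lia.
have xj : x %/ m < 2 by rewrite ltn_divLR.
have yj : y %/ m < 2 by rewrite ltn_divLR.
have := top (x %% m) (y %% m) (x %/ m) (y %/ m) (x %/ m).+1 (y %/ m).+1.
by rewrite !ltn_mod !mulSnr !addnA ![_ %% m + _]addnC -!divn_eq; apply => //; lia.
Qed.

Lemma shift_down m P x y : top_closed m P -> x < 2 * m -> y < 2 * m ->
  P (x + m) (y + m) -> P x y.
Proof.
move=> top xm ym; have m0 : 0 < m by lia.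
have xj : x %/ m < 2 by rewrite ltn_divLR.
have yj : y %/ m < 2 by rewrite ltn_divLR.
have := top (x %% m) (y %% m) (x %/ m).+1 (y %/ m).+1 (x %/ m) (y %/ m).
by rewrite !ltn_mod !mulSnr !addnA ![_ %% m + _]addnC -!divn_eq; apply => //; lia.
Qed.

Lemma swap_top m P i i' : top_closed m P -> i < m -> i' < m ->
  P (i + m) i' -> P i (i' + m).
Proof.
move=> top im im'; have := top i i' 1 0 0 1 im im'.
by rewrite !mul1n !mul0n !addn0; exact.
Qed.

Lemma raise_top m P i i' : top_closed m P -> i < m -> i' < m ->
  P i (i' + m) -> P i (i' + 2 * m).
Proof.
move=> top im im'; have := top i i' 0 1 0 2 im im'.
by rewrite !mul1n !mul0n !addn0; exact.
Qed.

(** A column {3k, 3k+1, 3k+2} makes (x, x+1) equivalent to (x+1, x+2) when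
    3 | x; otherwise one of x + m, x + 2m is divisible by 3, so the three points
    are first shifted into one column. *)
Lemma adjacent_pair m P x : 1 < m -> ~~ (3 %| m) ->
  top_closed m P -> bottom_closed m P -> P 0 1 -> x + 1 < 3 * m -> P x (x + 1).
Proof.
move=> m1 m3 top bot P01; elim: x => [//|x IH] xm.
have {}IH : P x (x + 1) by apply: IH; lia.
have up := fun y => @shift_up m P y (y + 1) top.
have dn := fun y => @shift_down m P y (y + 1) top.
(* a column containing x, x + 1 and x + 2 *)
have col y : y %% 3 = 0 -> y + 2 < 3 * m -> P y (y + 1) -> P (y + 1) (y + 1 + 1).
  by move=> *; apply: (bottom_move bot _ _ _ _ _ (x := y) (y := y + 1)) => //; lia.
have up' y : y + 1 < 2 * m -> P y (y + 1) -> P (y + m) (y + m + 1).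
  by move=> ym Py; rewrite addnAC; apply: up => //; lia.
have dn' y : y + 1 < 2 * m -> P (y + m) (y + m + 1) -> P y (y + 1).
  by move=> ym Py; apply: dn => //; first lia; rewrite addnAC.
(* S1 and S2 shift up by m and 2m; S3 and S4 shift down by m and 2m, which has
   the same effect mod 3 as shifting up by 2m and m *)
have S1 : (x + m) %% 3 = 0 -> x + 2 < 2 * m -> P (x + 1) (x + 1 + 1).
  move=> e xm'; apply: (dn'); first lia.
  by rewrite [x + 1 + m]addnAC; apply: col => //; [lia | apply: (up') => //; lia].
have S2 : (x + m + m) %% 3 = 0 -> x + 2 < m -> P (x + 1) (x + 1 + 1).
  move=> e xm'; apply: (dn'); [lia|apply: (dn'); [lia|]].
  rewrite [x + 1 + m]addnAC [_ + 1 + m]addnAC; apply: col => //; first lia.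
  by apply: (up'); [lia|apply: (up'); [lia|]].
have S3 : (x + m + m) %% 3 = 0 -> m <= x -> P (x + 1) (x + 1 + 1).
  move=> e xm'; have -> : x + 1 = x - m + 1 + m by lia.
  apply: (up'); first lia; apply: col; [lia|lia|].
  by apply: (dn'); [lia | rewrite subnK].
have S4 : (x + m) %% 3 = 0 -> 2 * m <= x -> P (x + 1) (x + 1 + 1).
  move=> e xm'; have -> : x + 1 = x - m - m + 1 + m + m by lia.
  apply: (up'); [lia|apply: (up'); [lia|]]; apply: col; [lia|lia|].
  by apply: (dn'); [lia|apply: (dn'); [lia|]]; rewrite !subnK //; lia.
rewrite -addn1.
(* the points x, x+1, x+2 stay clear of the boundary between two piles: the gaps
   [2m-2, 2m) and [m-2, m) contain no x in the relevant residue class *)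
have [e|[e|e]] : x %% 3 = 0 \/ (x + m) %% 3 = 0 \/ (x + m + m) %% 3 = 0 by lia.
- by apply: col => //; lia.
- by have [/(S1 e)|/(S4 e)] : x + 2 < 2 * m \/ 2 * m <= x by lia.
- by have [/(S2 e)|/(S3 e)] : x + 2 < m \/ m <= x by lia.
Qed.

(** Two points congruent mod 3 can be moved together by 1 inside their columns
    unless they are at the end of them; as m is prime to 3, a shift by m takes
    them away from the end. *)
Lemma translate_pair m P e x : ~~ (3 %| m) ->
  top_closed m P -> bottom_closed m P -> 3 * e < m -> x + 1 + 3 * e < 3 * m ->
  P x (x + 3 * e) <-> P (x + 1) (x + 1 + 3 * e).
Proof.
move=> m3 top bot em.
have tr y : y + m + 3 * e < 3 * m -> P y (y + 3 * e) <-> P (y + m) (y + m + 3 * e).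
  move=> ym; rewrite [y + m + _]addnAC; split.
    by apply: shift_up => //; lia.
  by apply: shift_down => //; lia.
have col y : y %% 3 != 2 -> y + 1 + 3 * e < 3 * m ->
    P y (y + 3 * e) <-> P (y + 1) (y + 1 + 3 * e).
  by move=> *; split; apply: (bottom_move bot) => //; lia.
move=> xm; have [x2|x2] := eqVneq (x %% 3) 2; last exact: col.
have [xm'|xm'] := ltnP (x + 1 + 3 * e) (2 * m).
  rewrite (tr x) ?(tr (x + 1)); [|lia|lia].
  by rewrite [x + 1 + m]addnAC; apply: col; lia.
have -> : x = x - m + m by lia.
rewrite -(tr (x - m)); last lia.
rewrite [x - m + m + 1]addnAC -(tr (x - m + 1)); last lia.
by apply: col; lia.
Qed.

Lemma raise_second m P x y : top_closed m P -> x < m -> 2 * m <= y < 3 * m ->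
  P x (y - m) -> P x y.
Proof.
move=> top xm ym Pxy; have -> : y = y - 2 * m + 2 * m by lia.
apply: raise_top => //; first lia.
by have -> : y - 2 * m + m = y - m by lia.
Qed.

(** When 3 does not divide the difference c, a bottom move that brings the last
    digits to (2, 0) or, in a common column, to an adjacent pair, shortens it.
    The only pairs not shortened have last digits (2, 0) already, so that
    c = 1 mod 3; shifting them by m changes their digits, unless the points
    are in the first and last pile, where the second one comes down a pile.
    That last reduction leads to the difference c - m, which may be a multiple
    of 3: hence the disjunction in the induction hypothesis, which has to
    exclude multiples of 3 where this lemma serves to reach them. *)
Lemma pair_prime_to_3 m P c x : ~~ (3 %| m) ->
  top_closed m P -> bottom_closed m P ->
  1 < c -> c %% 3 != 0 -> x + c < 3 * m ->
  (forall b z, 0 < b < c -> (b %% 3 != 0) || (m < c) && (c %% 3 == 1) -> z + b < 3 * m -> P z (z + b)) ->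
  P x (x + c).
Proof.
move=> m3 top bot c1 c3 xm IH.
have bm x0 y x' y' := @bottom_move m P x0 y x' y' bot.
have direct z : z + c < 3 * m -> ~~ ((z %% 3 == 2) && ((z + c) %% 3 == 0)) -> P z (z + c).
  move=> zm res.
  have [c2|c2] : c = 2 \/ 2 < c by lia.
    have [z0|z0] : z %% 3 = 0 \/ z %% 3 != 0 by lia.
      by apply: (bm z (z + 1)) => //; try lia; apply: IH; lia.
    by apply: (bm (z + 2 - z %% 3) (z + 2 - z %% 3 + 1)); try lia; apply: IH; lia.
  (* the difference once the last digits are (2, 0) *)
  pose b := c + z %% 3 - (z + c) %% 3 - 2.
  by apply: (bm (z + 2 - z %% 3) (z + 2 - z %% 3 + b)); try (rewrite /b; lia);
    apply: IH; rewrite /b; lia.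
have [/andP[/eqP x2 /eqP y0]|] := boolP ((x %% 3 == 2) && ((x + c) %% 3 == 0)); last exact: direct.
have [xc|xc] := ltnP (x + c) (2 * m).
  apply: (shift_down top); [lia|lia|].
  by rewrite addnAC; apply: direct; lia.
have [mx|mx] := leqP m x.
  have -> : x + c = x - m + c + m by lia.
  rewrite -{1}(subnK mx); apply: (shift_up top); [lia|lia|].
  by apply: direct; lia.
apply: (raise_second top) => //; first lia.
by rewrite -addnBA; [apply: IH; lia | lia].
Qed.

(** Symmetry of P serves the top moves that exchange two piles, which reverse
    the order of the two points. *)
Lemma pair_transitive_lt m P d x : 1 < m -> ~~ (3 %| m) ->
  top_closed m P -> bottom_closed m P -> (forall x y, P x y -> P y x) ->
  P 0 1 -> 0 < d -> x + d < 3 * m -> P x (x + d).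
Proof.
move=> m1 m3 top bot symP P01.
have bm x0 y x' y' := @bottom_move m P x0 y x' y' bot.
have [k] := ubnP d; elim: k d x => // k IH d x dk d0 xm.
have {dk}IH b z : 0 < b < d -> z + b < 3 * m -> P z (z + b) by move=> *; apply: IH; lia.
have [d1|d1] := leqP d 1.
  by have -> : d = 1 by [lia]; apply: (@adjacent_pair m); lia || done.
have [d3|d3] := eqVneq (d %% 3) 0; last first.
  by apply: (pair_prime_to_3 m3 top bot) => // b z bd _; exact: IH.
have [e de] : exists e, d = 3 * e by exists (d %/ 3); lia.
have [dm|dm] := leqP m d.
  (* exchanging the piles of z and z + d turns the difference d into 2m - d,
     which is smaller since d > m *)
  have low z : z < m -> z + d < 2 * m -> P z (z + d).
    move=> zm zd; have -> : z + d = z + d - m + m by lia.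
    apply: (swap_top top); [lia|lia|apply: symP].
    have -> : z + m = z + d - m + (2 * m - d) by lia.
    by apply: IH; lia.
  have [mx|mx] := leqP m x.
    have -> : x + d = x - m + d + m by lia.
    by rewrite -{1}(subnK mx); apply: (shift_up top); [lia|lia|apply: low; lia].
  have [xd|xd] := ltnP (x + d) (2 * m); first exact: low.
  by apply: (raise_second top); [lia|lia|rewrite -addnBA //; apply: IH; lia].
have gap1 z : z + (d + 1) < 3 * m -> P z (z + (d + 1)).
  move=> zm; apply: (pair_prime_to_3 m3 top bot) => //; try lia.
  by move=> b y bd bm' ym; apply: IH; lia.
have gap2 z : z + (d + 2) < 3 * m -> P z (z + (d + 2)).
  move=> zm; apply: (pair_prime_to_3 m3 top bot) => //; try lia.
  move=> b y bd bm' ym; have [b1|bd'] : b = d + 1 \/ b < d by lia.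
    by rewrite b1; apply: gap1; lia.
  by apply: IH; lia.
(* d + 1 (if m = 1 mod 3) or d + 2 (if m = 2 mod 3) is turned into
   2m - d - 1 or 2m - d - 2 by exchanging piles; a bottom move then brings the
   pair to (0, 2m - d), and exchanging piles again gives the difference d *)
have far : P 0 (2 * m - d).
  have [m31|m32] : m %% 3 = 1 \/ m %% 3 = 2 by lia.
    apply: (bm 0 (2 * m - d - 1)); try lia.
    have -> : 2 * m - d - 1 = m - d - 1 + m by lia.
    apply: (swap_top top); [lia|lia|apply: symP].
    by have -> : 0 + m = m - d - 1 + (d + 1) by [lia]; apply: gap1; lia.
  apply: (bm 1 (2 * m - d - 1)); try lia.
  have -> : 2 * m - d - 1 = m - d - 1 + m by lia.
  apply: (swap_top top); [lia|lia|apply: symP].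
  by have -> : 1 + m = m - d - 1 + (d + 2) by [lia]; apply: gap2; lia.
have base : P (m - d) (m - d + d).
  have -> : m - d + d = 0 + m by lia.
  apply: (swap_top top); [lia|lia|apply: symP].
  by have -> : m - d + m = 2 * m - d by lia.
have slide z : z + d < 3 * m -> P 0 d <-> P z (z + d).
  elim: z => [|z IHz] zm; first by rewrite add0n.
  rewrite IHz; last lia.
  by rewrite -addn1 de; apply: (@translate_pair m) => //; lia.
by rewrite -slide // (slide (m - d)) //; lia.
Qed.

(** * Moving two cards with the shuffle group *)

(** Some element of the group sends the positions x, y to x', y'.  Positions are
    numbers rather than ordinals so that arithmetic applies; x and y are forced
    to be smaller than 3n. *)
Definition moves n (x y x' y' : nat) : Prop :=
  exists (g : {perm 'I_(3 * n)}) (X Y : 'I_(3 * n)),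
    [/\ g \in shuffle_group n, X = x :> nat, Y = y :> nat, g X = x' :> nat & g Y = y' :> nat].

Lemma moves_refl n x y : x < 3 * n -> y < 3 * n -> moves n x y x y.
Proof.
move=> xn yn; exists 1%g, (Ordinal xn), (Ordinal yn).
by rewrite group1 !perm1.
Qed.

Lemma moves_trans n x2 y2 x1 y1 x3 y3 :
  moves n x1 y1 x2 y2 -> moves n x2 y2 x3 y3 -> moves n x1 y1 x3 y3.
Proof.
move=> [g [X [Y [Gg X1 Y1 gX gY]]]] [h [X' [Y' [Gh X2 Y2 hX hY]]]].
exists (g * h)%g, X, Y; rewrite groupM // !permM; split=> //.
  by rewrite -hX; congr (val (h _)); apply: val_inj; rewrite /= gX.
by rewrite -hY; congr (val (h _)); apply: val_inj; rewrite /= gY.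
Qed.

Lemma moves_sym n x y x' y' : moves n x y x' y' -> moves n x' y' x y.
Proof.
move=> [g [X [Y [Gg X1 Y1 gX gY]]]]; exists (g^-1)%g, (g X), (g Y).
by rewrite groupV !permK.
Qed.

Lemma pile_perm_shuffle_in n tau : (pile_perm n tau * shuffle n)%g \in shuffle_group n.
Proof. by apply: mem_gen; apply/imsetP; exists tau. Qed.

Lemma shuffle_in n : shuffle n \in shuffle_group n.
Proof.
have := pile_perm_shuffle_in n 1; suff -> : pile_perm n 1 = 1%g by rewrite mul1g.
by apply/permP => x; rewrite -(pointK x) pile_permE !perm1.
Qed.

Lemma pile_perm_in n tau : pile_perm n tau \in shuffle_group n.
Proof. by rewrite -(groupMr _ (shuffle_in n)) pile_perm_shuffle_in. Qed.

Lemma perm_of_pairs (T : finType) (j j' t t' : T) :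
  (j == j') = (t == t') -> exists tau : {perm T}, tau j = t /\ tau j' = t'.
Proof.
have [<- /esym/eqP <-|jj' /esym tt'] := eqVneq j j'; first by exists (tperm j t); rewrite tpermL.
exists (tperm j t * tperm (tperm j t j') t')%g; rewrite !permM tpermL; split; last exact: tpermL.
rewrite tpermD // 1?eq_sym ?tt' //.
by rewrite -[X in X != _](tpermL j t) (inj_eq perm_inj).
Qed.

Lemma moves_pile n i i' j j' t t' :
  i < n -> i' < n -> j < 3 -> j' < 3 -> t < 3 -> t' < 3 -> (j == j') = (t == t') ->
  moves n (i + j * n) (i' + j' * n) (i + t * n) (i' + t' * n).
Proof.
move=> iP i'P jP j'P tP t'P jt.
have [tau [tauj tauj']] := @perm_of_pairs _ (Ordinal jP) (Ordinal j'P) (Ordinal tP) (Ordinal t'P) jt.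
exists (pile_perm n tau), (point (Ordinal iP) (Ordinal jP)), (point (Ordinal i'P) (Ordinal j'P)).
by rewrite pile_perm_in !pile_permE tauj tauj'.
Qed.

Lemma moves_shuffle n i i' j j' : i < n -> i' < n -> j < 3 -> j' < 3 ->
  moves n (i + j * n) (i' + j' * n) (3 * i + j) (3 * i' + j').
Proof.
move=> iP i'P jP j'P.
exists (shuffle n), (point (Ordinal iP) (Ordinal jP)), (point (Ordinal i'P) (Ordinal j'P)).
by rewrite shuffle_in !shuffleE.
Qed.

(** shuffle^k in the mixed base (3^k, M): one shuffle takes the leading ternary
    digit of a position to its end, so k of them take the k leading digits,
    read as the number J, behind the remainder h. *)
Lemma moves_rotate n k M J J' h h' : 3 ^ k * M = 3 * n ->
  J < 3 ^ k -> J' < 3 ^ k -> h < M -> h' < M ->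
  moves n (J * M + h) (J' * M + h') (3 ^ k * h + J) (3 ^ k * h' + J').
Proof.
elim: k M J J' h h' => [|k IH] M J J' h h' kM Jk J'k hM h'M.
  have [-> ->] : J = 0 /\ J' = 0 by move: Jk J'k; rewrite expn0; lia.
  rewrite !mul0n !add0n !mul1n !addn0; move: kM; rewrite mul1n => kM.
  by apply: moves_refl; rewrite -kM.
have nE : n = 3 ^ k * M by apply/eqP; rewrite -(eqn_pmul2l (isT : 0 < 3)) -kM expnS mulnA.
have k0 : 0 < 3 ^ k by rewrite expn_gt0.
have first_step A g : A < 3 ^ k.+1 -> g < M ->
  [/\ A * M + g = (A %% 3 ^ k * M + g) + A %/ 3 ^ k * n, A %% 3 ^ k * M + g < n,
      A %/ 3 ^ k < 3 & A %% 3 ^ k < 3 ^ k].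
  move=> Ak gM; split.
  - by rewrite {1}(divn_eq A (3 ^ k)) nE; lia.
  - have := ltn_pmod A k0; rewrite nE; nia.
  - by rewrite ltn_divLR // -expnS.
  - exact: ltn_pmod.
have [e1 l1 q1 r1] := first_step _ _ Jk hM; have [e2 l2 q2 r2] := first_step _ _ J'k h'M.
rewrite e1 e2; apply: moves_trans (moves_shuffle l1 l2 q1 q2) _.
have := IH (3 * M) (J %% 3 ^ k) (J' %% 3 ^ k) (3 * h + J %/ 3 ^ k) (3 * h' + J' %/ 3 ^ k).
have F A g : A %% 3 ^ k * (3 * M) + (3 * g + A %/ 3 ^ k) =
  3 * (A %% 3 ^ k * M + g) + A %/ 3 ^ k by lia.
have E A g : 3 ^ k * (3 * g + A %/ 3 ^ k) + A %% 3 ^ k = 3 ^ k.+1 * g + A.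
  by rewrite [in RHS](divn_eq A (3 ^ k)) expnS; lia.
by rewrite !F !E; apply => //; rewrite ?nE; lia.
Qed.

(** * From [3m] to [3n] *)

(** The pairs (x, y) that can be reached with the low parts v and w unchanged
    are closed under top moves, given by pile permutations, and under bottom
    moves, which are pile permutations conjugated by shuffle^(a+1). *)
Lemma moves_middle n a m v w x y x' y' :
  n = 3 ^ a * m -> 1 < m -> ~~ (3 %| m) -> v < 3 ^ a -> w < 3 ^ a ->
  x < 3 * m -> y < 3 * m -> x' < 3 * m -> y' < 3 * m -> x != y -> x' != y' ->
  moves n (3 ^ a * x + v) (3 ^ a * y + w) (3 ^ a * x' + v) (3 ^ a * y' + w).
Proof.
move=> nE m1 m3 va wa.
have a0 : 0 < 3 ^ a by rewrite expn_gt0.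
have lt u k : u < 3 ^ a -> k < m -> 3 ^ a * k + u < n by rewrite nE; nia.
have ltN u k : u < 3 ^ a -> k < 3 * m -> 3 ^ a * k + u < 3 * n by rewrite nE; nia.
pose P x y x' y' :=
  moves n (3 ^ a * x + v) (3 ^ a * y + w) (3 ^ a * x' + v) (3 ^ a * y' + w).
have top x0 y0 : top_closed m (P x0 y0).
  move=> i i' j j' t t' im i'm j3 j'3 t3 t'3 jt; rewrite /P => /moves_trans; apply.
  have E k u r : 3 ^ a * (k + r * m) + u = 3 ^ a * k + u + r * n by rewrite nE; lia.
  by rewrite !E; apply: moves_pile => //; apply: lt.
have bot x0 y0 : bottom_closed m (P x0 y0).
  move=> k k' r r' s s' km k'm r3 r'3 s3 s'3 rs; rewrite /P => /moves_trans; apply.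
  have rot c c' : c < 3 -> c' < 3 ->
      moves n (v * m + k + c * n) (w * m + k' + c' * n)
              (3 ^ a * (3 * k + c) + v) (3 ^ a * (3 * k' + c') + w).
    move=> c3 c'3; have := @moves_rotate n a.+1 m (3 ^ a * c + v) (3 ^ a * c' + w) k k'.
    have E g b u : (3 ^ a * b + u) * m + g = u * m + g + b * n by rewrite nE; lia.
    have F g b u : 3 ^ a.+1 * g + (3 ^ a * b + u) = 3 ^ a * (3 * g + b) + u.
      by rewrite expnS; lia.
    by rewrite !E !F; apply => //; rewrite expnS ?nE; nia.
  apply: moves_trans (moves_sym (rot r r' r3 r'3)) _.
  apply: moves_trans (rot s s' s3 s'3).
  by apply: moves_pile => //; rewrite nE; nia.
have all_pairs b c x0 y0 : b < 3 * m -> c < 3 * m -> b != c -> P x0 y0 0 1 -> P x0 y0 b c.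
  move=> bm cm bc P01.
  (* the induction on the difference works with unordered pairs *)
  pose Q x y := P x0 y0 x y /\ P x0 y0 y x.
  have topQ : top_closed m Q.
    move=> i i' j j' t t' im i'm j3 j'3 t3 t'3 jt [P1 P2].
    by split; [apply: top P1 | apply: top P2] => //; rewrite eq_sym jt eq_sym.
  have botQ : bottom_closed m Q.
    move=> k k' r r' s s' km k'm r3 r'3 s3 s'3 rs [P1 P2].
    by split; [apply: bot P1 | apply: bot P2] => //; rewrite eq_sym rs eq_sym.
  have Q01 : Q 0 1.
    by split=> //; apply: (bot x0 y0 0 0 0 1 1 0) => //; lia.
  have symQ x1 y1 : Q x1 y1 -> Q y1 x1 by case.
  have lt_pairs z d := @pair_transitive_lt m Q d z m1 m3 topQ botQ symQ Q01.
  have [bc'|bc'] := leqP b c.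
    by rewrite -(subnKC bc'); apply: (proj1 (lt_pairs b (c - b) _ _)); lia.
  by rewrite -{1}(subnKC (ltnW bc')); apply: (proj2 (lt_pairs c (b - c) _ _)); lia.
move=> xm ym x'm y'm xy xy'.
have P0 : P 0 1 0 1 by apply: moves_refl; apply: ltN => //; lia.
exact: moves_trans (moves_sym (all_pairs _ _ 0 1 xm ym xy P0)) (all_pairs _ _ 0 1 x'm y'm xy' P0).
Qed.

(** If k = 1 and k = 2 both failed, then either 3m would divide a difference
    3^a, against m > 1 being prime to 3, or 3 would divide both v and v + 1. *)
Lemma consecutive_nonmultiples a m v : 1 < m -> ~~ (3 %| m) -> v.+1 < 3 ^ a ->
  exists k, [/\ 0 < k, k <= 2,
    ~~ (3 * m %| 3 ^ a * k + v) & ~~ (3 * m %| 3 ^ a * k + v.+1)].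
Proof.
move=> m1 m3 va.
have [b aE] : exists b, 3 ^ a = 3 * b.
  by case: a va => [|a] va; [move: va | exists (3 ^ a); rewrite expnS].
have not_pow c : 3 * m %| c -> 3 * m %| c + 3 ^ a -> False.
  move=> mc; rewrite dvdn_addr // => ma.
  have : m %| 1; last by rewrite dvdn1; lia.
  have cop : coprime m (3 ^ a) by rewrite coprimeXr // coprime_sym prime_coprime.
  by rewrite -(Gauss_dvdl _ cop) mul1n; apply: dvdn_trans ma; apply: dvdn_mull.
have three c d : 3 * m %| 3 ^ a * c + d -> 3 %| d.
  by rewrite aE => /(dvdn_trans (dvdn_mulr m (dvdnn 3))); lia.
have [/andP[y1 y2]|bad1] := boolP (~~ (3 * m %| 3 ^ a * 1 + v) && ~~ (3 * m %| 3 ^ a * 1 + v.+1)).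
  by exists 1.
exists 2; move: bad1; rewrite negb_and !negbK => /orP[] d1; split=> //; apply/negP => d2.
- by apply: (not_pow _ d1); move: d2; congr (_ %| _); lia.
- by have := three _ _ d1; have := three _ _ d2; lia.
- by have := three _ _ d1; have := three _ _ d2; lia.
- by apply: (not_pow _ d1); move: d2; congr (_ %| _); lia.
Qed.

(** By moves_middle, z = 3^a * u + v may change its high part u as long as it
    stays positive, and after rotation z = 3m * w + x may change its low part x
    as long as it stays positive; alternating the two ways of cutting reaches
    every value of v. *)
Lemma moves_nonzero n a m z : n = 3 ^ a * m -> 1 < m -> ~~ (3 %| m) ->
  0 < z < 3 * n -> moves n 0 z 0 (3 ^ a).
Proof.
move=> nE m1 m3.
have a0 : 0 < 3 ^ a by rewrite expn_gt0.
have mid v x y : v < 3 ^ a -> 0 < x < 3 * m -> 0 < y < 3 * m ->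
    moves n 0 (3 ^ a * x + v) 0 (3 ^ a * y + v).
  move=> va xm ym; have := @moves_middle n a m 0 v 0 x 0 y nE m1 m3 a0 va.
  by rewrite muln0 addn0; apply; lia.
have low w x y : w < 3 ^ a -> 0 < x < 3 * m -> 0 < y < 3 * m ->
    moves n 0 (w * (3 * m) + x) 0 (w * (3 * m) + y).
  move=> wa xm ym.
  have rot u : 0 < u < 3 * m -> moves n 0 (w * (3 * m) + u) 0 (3 ^ a * u + w).
    move=> um; have := @moves_rotate n a (3 * m) 0 w 0 u.
    by rewrite muln0 mul0n !addn0; apply => //; rewrite ?nE; lia.
  apply: moves_trans (rot x xm) (moves_trans _ (moves_sym (rot y ym))).
  exact: mid.
(* y = 3^a k + v and y + 1 agree outside their lowest part mod 3m, so they link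
   the orbits of 3^a + v and 3^a + v + 1 *)
have link v : v.+1 < 3 ^ a -> moves n 0 (3 ^ a + v) 0 (3 ^ a + v.+1).
  move=> va.
  have [k [k0 k2 y0 y1]] : exists k, [/\ 0 < k, k <= 2,
      ~~ (3 * m %| 3 ^ a * k + v) & ~~ (3 * m %| 3 ^ a * k + v.+1)].
    exact: consecutive_nonmultiples.
  pose y := 3 ^ a * k + v.
  have yN : y < 3 ^ a * (3 * m) by rewrite /y; nia.
  have m0 : 0 < 3 * m by lia.
  have := mid v 1 k (ltnW va); rewrite muln1 => /(_ _ _)/moves_trans; apply; try lia.
  have := mid v.+1 k 1 va; rewrite muln1 => /(_ _ _)/(moves_trans _); apply; try lia.
  have -> : 3 ^ a * k + v.+1 = y %/ (3 * m) * (3 * m) + (y %% (3 * m)).+1.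
    by rewrite !addnS -divn_eq.
  rewrite -[3 ^ a * k + v]/y [X in moves n 0 X](divn_eq y (3 * m)).
  have ym : (y %% (3 * m)).+1 < 3 * m.
    rewrite ltn_neqAle ltn_pmod // andbT; apply: contra y1 => /eqP y1.
    by rewrite addnS -/y /dvdn -addn1 -modnDml addn1 y1 modnn.
  apply: low; first by rewrite ltn_divLR.
    by rewrite lt0n y0 ltn_pmod.
  by rewrite ltn0Sn.
have chain v : v < 3 ^ a -> moves n 0 (3 ^ a + v) 0 (3 ^ a).
  elim: v => [|v IH] va; first by rewrite addn0; apply: moves_refl; rewrite nE; nia.
  exact: moves_trans (moves_sym (link v va)) (IH (ltnW va)).
have big y : 3 ^ a <= y -> y < 3 * n -> moves n 0 y 0 (3 ^ a).
  move=> ya yn; apply: moves_trans (chain (y %% 3 ^ a) (ltn_pmod _ a0)).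
  rewrite {1}(divn_eq y (3 ^ a)) mulnC -[X in _ 0 (X + _)]muln1.
  apply: mid; rewrite ?ltn_pmod //; last lia.
  by rewrite divn_gt0 // ya ltn_divLR // -mulnA [m * _]mulnC -nE.
(* the shuffle multiplies a position of the first pile by 3 *)
have [k] := ubnP (3 ^ a - z); elim: k z => // k IH z zk /andP[z0 zn].
have [|za] := leqP (3 ^ a) z; first by move/big; apply.
have zn' : z < n by rewrite nE; nia.
have n0 : 0 < n by lia.
have := moves_shuffle n0 zn' (isT : 0 < 3) (isT : 0 < 3).
rewrite !mul0n !addn0 => /moves_trans; apply.
by apply: IH; lia.
Qed.

Theorem theorem1p2 (n : nat) (n_gt0 : 0 < n) (n_dvd3 : 3 %| n)
    (n_npow3 : ~ exists k : nat, n = 3 ^ k) :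
  [transitive^2 shuffle_group n, on [set: 'I_(3 * n)] | 'P].
Proof.
have [m m3 nE] := pfactor_coprime (isT : prime 3) n_gt0.
rewrite prime_coprime // in m3; rewrite mulnC in nE; set a := logn 3 n in nE.
have m1 : 1 < m.
  case: m => [|[|m]] // in m3 nE *.
  by case: n_npow3; exists a; rewrite nE muln1.
have a0 : 0 < 3 ^ a by rewrite expn_gt0.
have N0 : 0 < 3 * n by lia.
pose o := Ordinal N0.
have nonzero (X : 'I_(3 * n)) : X != o -> 0 < X.
  by move=> Xo; rewrite lt0n; apply: contra Xo => /eqP X0; apply/eqP/val_inj.
have carry (X Y X' Y' : 'I_(3 * n)) : moves n X Y X' Y' ->
    exists2 g, g \in shuffle_group n & g X = X' /\ g Y = Y'.
  case=> [g [X1 [Y1 [Gg /val_inj eX /val_inj eY /val_inj gX /val_inj gY]]]].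
  by exists g; rewrite -?eX -?eY.
have wN : 3 ^ a < 3 * n by rewrite nE; nia.
pose w := Ordinal wN.
have ow : w != o by rewrite -val_eqE /= -lt0n.
have to_w (X : 'I_(3 * n)) : X != o -> moves n o X o w.
  by move=> Xo; apply: (moves_nonzero nE m1 m3); rewrite nonzero //=.
have swap_ow : moves n o w w o.
  have := @moves_middle n a m 0 0 0 1 1 0 nE m1 m3 a0 a0.
  by rewrite muln0 muln1 !addn0; apply => //; lia.
have transG : [transitive shuffle_group n, on [set: 'I_(3 * n)] | 'P].
  apply/imsetP; exists o => //; apply/setP => X; rewrite inE; symmetry.
  apply/orbitP; have [->|Xo] := eqVneq X o; first by exists 1%g; rewrite //= apermE perm1.
  have [g Gg [gw _]] := carry _ _ _ _ swap_ow.
  have [h Gh [_ hw]] := carry _ _ _ _ (moves_sym (to_w X Xo)).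
  by exists (g * h)%g; rewrite ?groupM //= apermE permM gw.
apply: (@stab_ntransitiveI _ _ _ _ _ _ o) => //.
apply: (@stab_ntransitiveI _ _ _ _ _ _ w); rewrite ?ntransitive0 // ?inE ?ow //.
apply/imsetP; exists w; first by rewrite !inE ow.
apply/setP => X; rewrite !inE andbT; apply/idP/orbitP => [Xo | [g]].
  have [g Gg [go gw]] := carry _ _ _ _ (moves_sym (to_w X Xo)).
  by exists g => //; rewrite inE Gg; apply/astab1P; rewrite /= apermE.
case/setIP=> _ /astab1P; rewrite /= apermE => go <-.
by rewrite apermE -[X in _ != X]go (inj_eq perm_inj).
Qed.
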